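(* Let $n$ be a positive integer. Then $\mathsf s_{\{\pm1\}}(\mathbb Z_n^2)\le 2n+1$. More precisely, letting $u$ denote the exponent of the largest power of $2$ dividing $n$: (i) $\mathsf s_{\{\pm1\}}(\mathbb Z_2^2)=5$, $\mathsf s_{\{\pm1\}}(\mathbb Z_4^2)=8$ and $\mathsf s_{\{\pm1\}}(\mathbb Z_8^2)=14$; (ii) if $u\le1$, then $\mathsf s_{\{\pm1\}}(\mathbb Z_n^2)\le 2n+1$; (iii) if $u=2$, then $\mathsf s_{\{\pm1\}}(\mathbb Z_n^2)\le 2n$; (iv) if $u\ge3$, then $\mathsf s_{\{\pm1\}}(\mathbb Z_n^2)\le\frac{15}{8}n+1$.
   Context: $\mathbb Z_n^2=\mathbb Z_n\oplus\mathbb Z_n$. A sequence over a finite abelian group $G$ is a finite (unordered) list of elements of $G$, repetitions allowed; a subsequence is a sublist and its length is its number of terms. A sequence $g_1,\ldots,g_m$ is a $\{\pm1\}$-weighted zero-sum sequence if there exist $\varepsilon_1,\ldots,\varepsilon_m\in\{1,-1\}$ with $\sum_{i=1}^m\varepsilon_ig_i=0$. $\mathsf s_{\{\pm1\}}(G)$ is the least integer $m$ such that every sequence over $G$ of length at least $m$ has a $\{\pm1\}$-weighted zero-sum subsequence of length $\exp(G)$. *)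

(* Defs.v *)
From HB Require Import structures.
From mathcomp Require Import all_boot all_order all_algebra all_fingroup all_solvable.
From mathcomp Require boolp.

Set Implicit Arguments.
Unset Strict Implicit.
Unset Printing Implicit Defensive.

Import GRing.Theory.
Local Open Scope ring_scope.

Definition pm_zero_sum (G : zmodType) (t : seq G) : Prop :=
  exists eps : 'I_(size t) -> int,
    (forall i, eps i = 1 \/ eps i = -1) /\ \sum_(i < size t) t`_i *~ eps i = 0.

(* [exponent] is the group-theoretic exponent of the additive group of [G].
   Sequences are represented by ordered lists: their sublists are, up to order,
   exactly the sub-multisets, and [pm_zero_sum] does not depend on the order. *)
Definition pm_bound (G : finZmodType) (m : nat) : Prop :=
  forall s : seq G, (m <= size s)%N ->
    exists t : seq G,
      [/\ subseq t s, size t = exponent [set: G] & pm_zero_sum t].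

Lemma pm_bound_exists (G : finZmodType) : exists m, boolp.asbool (pm_bound G m).
Proof.
exists (#|G| * exponent [set: G])%N; apply/boolp.asboolP => s le_s.
have e_gt0 : (0 < exponent [set: G])%N by exact: exponent_gt0.
have [g le_g] : exists g : G, (exponent [set: G] <= count_mem g s)%N.
  apply/existsP; apply: contraLR le_s; rewrite negb_exists -ltnNge => /forallP H.
  have -> : size s = (\sum_(g : G) count_mem g s)%N.
    elim: s {H} => [|x s IHs] /=; first by rewrite big1.
    rewrite big_split /= -IHs (bigD1 x) //= eqxx big1 ?addn0 // => y.
    by rewrite eq_sym => /negPf ->.
  have card_gt0 : (0 < #|G|)%N by apply/card_gt0P; exists 0.
  rewrite -sum_nat_const; rewrite (bigD1 (0 : G)) //= [ltnRHS](bigD1 (0 : G)) //=.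
  rewrite -addSn leq_add //; first by rewrite ltnNge H.
  by apply: leq_sum => i _; apply: ltnW; rewrite ltnNge H.
exists (nseq (exponent [set: G]) g); split; last 2 first.
- by rewrite size_nseq.
- exists (fun=> 1); split; first by left.
  rewrite (eq_bigr (fun=> g)) => [|i _]; last first.
    by rewrite mulr1z nth_nseq -{2}(size_nseq (exponent [set: G]) g) ltn_ord.
  rewrite sumr_const card_ord size_nseq -FinRing.zmodXgE.
  by rewrite expg_exponent ?inE.
apply: subseq_trans (filter_subseq (pred1 g) s).
have /all_pred1P -> := filter_all (pred1 g) s; rewrite size_filter.
by rewrite -(subnKC le_g) nseqD prefix_subseq.
Qed.

Definition s_pm (G : finZmodType) : nat := ex_minn (pm_bound_exists G).

(* Direct sums of finite abelian groups: the library has the two structures on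
   the product type but not their join. *)
HB.instance Definition _ (A B : finZmodType) := GRing.Zmodule.on (A * B)%type.

(* For [n > 0] the type ['I_n.-1.+1] carries the additive group of integers
   modulo [n]; ['Z_n] would be Z/2 when [n = 1]. *)
Definition Zn2 (n : nat) : finZmodType := ('I_n.-1.+1 * 'I_n.-1.+1)%type.

(* Main.v *)
(* If every a-term sequence over Z_m^2 and every b-term sequence over Z_k^2 has a
   plus-minus zero-sum subsequence of length m, resp. k, then a sequence of
   m(b-1)+a terms over Z_mk^2 contains b disjoint m-term blocks whose signed sums
   vanish modulo m; dividing these sums by m and choosing k blocks among them
   gives mk terms.  This reduces everything to odd primes and to n = 2, 4, 8.
   For an odd prime p and 2p-1 terms (a_i, b_i), Chevalley's theorem applied to
     sum a_i x_i^((p-1)/2), sum b_i x_i^((p-1)/2), sum x_i^(p-1)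
   gives a nontrivial zero: its support has p elements, and x_i^((p-1)/2) are the
   signs.  For n = 4 a finite search is made.  For n = 8, subsets of equal
   residue and equal parity have a symmetric difference which is a signed
   zero-sum of even length.  Among 10 terms at least 8 subsets share residue and
   parity, so Plotkin's bound excludes that all distances exceed 4 without being
   8: there is a zero-sum of length 2, 4 or 8.  Among 8 terms there is one of
   even length.  Combining disjoint zero-sums, 14 terms yield one of length 8. *)
Require Import Defs.
From mathcomp Require Import all_boot all_order all_algebra all_fingroup.
From mathcomp Require Import all_solvable all_field zify lra.

Set Implicit Arguments.
Unset Strict Implicit.
Unset Printing Implicit Defensive.

Import Order.TTheory GRing.Theory Num.Theory.
Local Open Scope ring_scope.

(** * Chevalley's theorem over a finite field *)

(** For positive [k], at most [k] elements satisfy [y ^+ k = 1], so some nonzero [y] does not.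
    Substituting [y * z] for [z] multiplies the sum by [y ^+ k], which forces it to vanish. *)
Lemma sum_expr_finField_eq0 (F : finFieldType) (k : nat) :
  (k < #|F|.-1)%N -> \sum_(y : F) y ^+ k = 0.
Proof.
case: k => [|k] ltkF.
  under eq_bigr do rewrite expr0.
  by rewrite sumr_const -cardsT -FinRing.zmodXgE expg_cardG ?inE.
have [y y_neq0 yk_neq1] : exists2 y : F, y != 0 & y ^+ k.+1 != 1.
  apply/exists_inP; apply: contraLR ltkF => /exists_inPn all1.
  rewrite -leqNgt -(cardC1 (0 : F)) cardE.
  apply: max_unity_roots (enum_uniq _) => //.
  apply/allP => y; rewrite mem_enum => y_neq0.
  by rewrite unity_rootE; apply/negPn/all1.
set S := \sum_y _; have : y ^+ k.+1 * S = S.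
  rewrite /S [RHS](reindex_inj (mulfI y_neq0)) mulr_sumr.
  by apply: eq_bigr => z _; rewrite exprMn.
move/eqP; rewrite -subr_eq0 -{2}[S]mul1r -mulrBl mulf_eq0 subr_eq0.
by rewrite (negPf yk_neq1) => /eqP.
Qed.

Section PolynomialFunctions.

Variables (F : finFieldType) (I : finType).

(** Degree is attached to functions instead of formal polynomials; by [DegExt] any representation by
    monomials may witness it. *)
Inductive deg_le (d : nat) : ({ffun I -> F} -> F) -> Prop :=
| DegMonomial a (e : I -> nat) :
    (\sum_i e i <= d)%N -> deg_le d (fun x => a * \prod_i x i ^+ e i)
| DegAdd f g : deg_le d f -> deg_le d g -> deg_le d (fun x => f x + g x)
| DegExt f g : f =1 g -> deg_le d f -> deg_le d g.

Lemma deg_le_cst d a : deg_le d (fun=> a).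
Proof.
apply: (@DegExt _ (fun x => a * \prod_i x i ^+ 0)) => [x|].
  by rewrite big1 ?mulr1.
by apply: DegMonomial; rewrite big1.
Qed.

Lemma deg_le_scale_expr a i k : deg_le k (fun x => a * x i ^+ k).
Proof.
apply: (@DegExt _ (fun x => a * \prod_j x j ^+ ((j == i) * k))) => [x|].
  rewrite (bigD1 i) //= eqxx mul1n big1 ?mulr1 // => j /negPf ->.
  by rewrite mul0n.
apply: DegMonomial; rewrite (bigD1 i) //= eqxx mul1n big1 ?addn0 // => j /negPf.
by move=> ->.
Qed.

Lemma deg_le_sum d (J : Type) (r : seq J) (f : J -> {ffun I -> F} -> F) :
  (forall j, deg_le d (f j)) -> deg_le d (fun x => \sum_(j <- r) f j x).
Proof.
move=> df; elim: r => [|j r IHr].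
  by apply: DegExt (deg_le_cst _ 0) => x; rewrite big_nil.
by apply: DegExt (DegAdd (df j) IHr) => x; rewrite big_cons.
Qed.

Lemma deg_le_mul d1 d2 f g :
  deg_le d1 f -> deg_le d2 g -> deg_le (d1 + d2) (fun x => f x * g x).
Proof.
move=> df dg; elim: df => [a e le_e|f1 f2 _ IH1 _ IH2|f1 f2 eqf _ IH].
- elim: dg => [b e' le_e'|g1 g2 _ IH1 _ IH2|g1 g2 eqg _ IH].
  + apply: (@DegExt _ (fun x => a * b * \prod_i x i ^+ (e i + e' i))) => [x|].
      under eq_bigr do rewrite exprD.
      by rewrite big_split /= mulrACA.
    by apply: DegMonomial; rewrite big_split leq_add.
  + by apply: DegExt (DegAdd IH1 IH2) => x; rewrite mulrDr.
  + by apply: DegExt IH => x; rewrite eqg.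
- by apply: DegExt (DegAdd IH1 IH2) => x; rewrite mulrDl.
- by apply: DegExt IH => x; rewrite eqf.
Qed.

Lemma deg_le_exp d f k : deg_le d f -> deg_le (k * d) (fun x => f x ^+ k).
Proof.
move=> df; elim: k => [|k IHk]; first exact: deg_le_cst.
by rewrite mulSn; apply: DegExt (deg_le_mul df IHk) => x; rewrite exprS.
Qed.

Lemma deg_le_prod (J : Type) (r : seq J) (d : J -> nat)
    (f : J -> {ffun I -> F} -> F) :
    (forall j, deg_le (d j) (f j)) ->
  deg_le (\sum_(j <- r) d j) (fun x => \prod_(j <- r) f j x).
Proof.
move=> df; elim: r => [|j r IHr].
  by apply: DegExt (deg_le_cst _ 1) => x; rewrite big_nil.
by rewrite big_cons; apply: DegExt (deg_le_mul (df j) IHr) => x; rewrite big_cons.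
Qed.

(** A monomial of degree below [#|I| * #|F|.-1] has an exponent below [#|F|.-1], and the sum over
    that variable is a vanishing factor. *)
Lemma sum_deg_le_eq0 d f :
  deg_le d f -> (d < #|I| * #|F|.-1)%N -> \sum_x f x = 0.
Proof.
move=> df lt_d; elim: df => [a e le_e|f1 f2 _ IH1 _ IH2|f1 f2 eqf _ IH].
- rewrite -mulr_sumr -(bigA_distr_bigA (fun i y => y ^+ e i)) /=.
  have [i lt_i] : exists i, (e i < #|F|.-1)%N.
    apply/existsP; apply: contraLR lt_d => /existsPn ge_e.
    rewrite -leqNgt (leq_trans _ le_e) // -sum_nat_const leq_sum // => i _.
    by rewrite leqNgt ge_e.
  by rewrite (bigD1 i) //= sum_expr_finField_eq0 ?mul0r ?mulr0.
- by rewrite big_split /= IH1 IH2 addr0.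
- by rewrite -[RHS]IH; apply: eq_bigr => x _; rewrite eqf.
Qed.

Theorem chevalley (J : finType) (d : J -> nat) (f : J -> {ffun I -> F} -> F) :
    (forall j, deg_le (d j) (f j)) -> (\sum_j d j < #|I|)%N ->
    (forall j, f j [ffun=> 0] = 0) ->
  exists2 x, x != [ffun=> 0] & forall j, f j x = 0.
Proof.
move=> df lt_d f0; pose q := #|F|.-1.
have q_gt0 : (0 < q)%N by rewrite /q -subn1 subn_gt0 finNzRing_gt1.
have exprq (y : F) : y != 0 -> y ^+ q = 1.
  move=> y_neq0; apply: (mulfI y_neq0).
  by rewrite -exprS prednK ?expf_card ?mulr1 // ltnW // finNzRing_gt1.
have [/exists_inP[x x_neq0 /forallP fx0]|/exists_inPn no_sol] :=
    boolP [exists (x | x != [ffun=> 0]), forall j, f j x == 0].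
  by exists x => // j; apply/eqP.
(* By [exprq] this product is the indicator function of the common zeros. If 0 were the only one,
   its sum over all points would be 1, against the degree bound. *)
have dP : deg_le (\sum_j q * d j) (fun x => \prod_j (1 - f j x ^+ q)).
  apply: deg_le_prod => j; apply: DegAdd; first exact: deg_le_cst.
  rewrite -[(q * d j)%N]add0n.
  by apply: DegExt (deg_le_mul (deg_le_cst 0 (-1)) (deg_le_exp q (df j))) => x; rewrite mulN1r.
have := sum_deg_le_eq0 dP.
rewrite -big_distrr /= mulnC ltn_pmul2r // => /(_ lt_d).
rewrite (bigD1 [ffun=> 0]) //= [X in _ + X]big1 => [|x /no_sol].
  rewrite big1 ?addr0 => [/eqP|j _]; first by rewrite oner_eq0.
  by rewrite f0 expr0n gtn_eqF // subr0.
rewrite negb_forall => /existsP[j fj_neq0].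
by rewrite (bigD1 j) //= exprq // subrr mul0r.
Qed.

End PolynomialFunctions.

(** * Signed zero-sums of integer pairs modulo n, and products of moduli *)

(** A term is a pair of integers with coordinates indexed by [bool]. Integers are kept instead of
    residues so that a block sum divisible by [m] can be divided by [m]; index sets account for
    repeated terms. *)
Definition pm_zero (n : nat) (I : finType) (g : I -> bool -> int) (D : {set I}) :=
  exists f : I -> bool,
    forall c, (n %| \sum_(i in D) (-1) ^+ f i * g i c)%Z.

Definition pm_forces (n m : nat) :=
  forall (I : finType) (g : I -> bool -> int) (X : {set I}), (m <= #|X|)%N ->
    exists D : {set I}, [/\ D \subset X, #|D| = n & pm_zero n g D].

Lemma pm_forces_leq n m m' : (m <= m')%N -> pm_forces n m -> pm_forces n m'.
Proof. by move=> le_mm' forces I g X le_X; apply: forces (leq_trans le_mm' le_X). Qed.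

Lemma subset_of_card (T : finType) (A : {set T}) k :
  (k <= #|A|)%N -> exists2 B : {set T}, B \subset A & #|B| = k.
Proof.
case/card_geqP=> s [uniq_s size_s sub_s]; exists [set x in s].
  by apply/subsetP => x; rewrite inE; apply: sub_s.
by rewrite cardsE -size_s; apply/card_uniqP.
Qed.

Lemma pm_zero_setU n (I : finType) (g : I -> bool -> int) (A B : {set I}) :
  [disjoint A & B] -> pm_zero n g A -> pm_zero n g B -> pm_zero n g (A :|: B).
Proof.
move=> disAB [f1 zA] [f2 zB]; exists (fun i => if i \in A then f1 i else f2 i) => c.
rewrite (eq_bigl [in [predU A & B]]) => [|i]; last by rewrite !inE.
rewrite bigU //= rpredD //.
  by rewrite (eq_bigr (fun i => (-1) ^+ f1 i * g i c)) // => i ->.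
rewrite (eq_bigr (fun i => (-1) ^+ f2 i * g i c)) // => i iB.
by rewrite (disjointFl disAB iB).
Qed.

Lemma pm_zero_cover (m k : nat) (I : finType) (g : I -> bool -> int) (f : {set I} -> I -> bool)
    (P : {set {set I}}) :
    trivIset P ->
    (forall A : {set I}, A \in P -> forall c, (m %| \sum_(i in A) (-1) ^+ f A i * g i c)%Z) ->
    pm_zero k (fun (A : {set I}) c => (\sum_(i in A) (-1) ^+ f A i * g i c) %/ m)%Z P ->
  pm_zero (m * k) g (cover P).
Proof.
move=> tiP fP [e eP].
(* The sign of [i] is its sign within its block times the sign of the block. *)
exists (fun i => f (pblock P i) i (+) e (pblock P i)) => c.
rewrite big_trivIset //=.
rewrite (eq_bigr (fun A => m%:Z * ((-1) ^+ e A *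
    ((\sum_(i in A) (-1) ^+ f A i * g i c) %/ m)%Z))) => [|A PA].
  by rewrite -mulr_sumr PoszM dvdz_mul.
rewrite mulrCA mulrC [m%:Z * _]mulrC divzK ?fP // mulr_suml.
by apply: eq_bigr => i Ai; rewrite (def_pblock tiP PA Ai) signr_addb mulrAC.
Qed.

Lemma pm_forces_mul m a k b :
  (0 < m)%N -> pm_forces m a -> pm_forces k b ->
  pm_forces (m * k) (m * b.-1 + a).
Proof.
move=> m_gt0 forces_m forces_k I g X le_X.
(* Blocks are taken greedily: after [j < b] of them at most [m * b.-1] terms are used, so at least
   [a] are left. *)
have disjoint_family j : (j <= b)%N -> exists P : {set {set I}},
    [/\ cover P \subset X, trivIset P, #|P| = j
      & forall A, A \in P -> #|A| = m /\ pm_zero m g A].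
  elim: j => [|j IHj] lt_j.
    exists set0; split; rewrite ?cards0 //; last by move=> A; rewrite inE.
      by rewrite /cover big_set0 sub0set.
    by apply/trivIsetP => A; rewrite inE.
  have [P [subPX tiP cardP allP]] := IHj (ltnW lt_j).
  have card_cover : #|cover P| = (m * j)%N.
    rewrite (card_uniform_partition (n := m) (P := P)) ?cardP // 1?mulnC //.
      by move=> A /allP[].
    rewrite /partition eqxx tiP; apply/negP => /allP[].
    by rewrite cards0 => m0; rewrite -m0 in m_gt0.
  have le_mj : (m * j <= m * b.-1)%N by rewrite leq_mul2l -ltnS (ltn_predK lt_j) lt_j orbT.
  have [|A [subA cardA zA]] := forces_m I g (X :\: cover P).
    rewrite cardsD (setIidPr subPX) card_cover leq_subRL.
      by rewrite (leq_trans _ le_X) // leq_add2r.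
    by rewrite (leq_trans le_mj) // (leq_trans (leq_addr a _)).
  move: subA; rewrite subsetD => /andP[subAX disA].
  have notP0 : set0 \notin P.
    by apply/negP => /allP[]; rewrite cards0 => m0; rewrite -m0 in m_gt0.
  have [|tiAP notPA] := trivIsetU1 _ tiP notP0 (A := A).
    move=> B PB; apply: disjointWr disA; exact: bigcup_sup PB.
  exists (A |: P); split=> //.
  - by rewrite /cover bigcup_setU big_set1 subUset subAX.
  - by rewrite cardsU1 notPA cardP.
  - by move=> B /setU1P[-> | /allP].
have [P [subPX tiP cardP allP]] := disjoint_family b (leqnn b).
have /fin_all_exists[f fP] : forall A : {set I}, exists f : I -> bool,
    A \in P -> forall c, (m %| \sum_(i in A) (-1) ^+ f i * g i c)%Z.
  move=> A; have [/allP[_ [f fA]]|_] := boolP (A \in P); first by exists f.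
  by exists (fun=> false).
have [|Q [subQP cardQ zQ]] := forces_k _
  (fun (A : {set I}) c => (\sum_(i in A) (-1) ^+ f A i * g i c) %/ m)%Z P; first by rewrite cardP.
have tiQ := trivIsetS subQP tiP.
exists (cover Q); split.
- by apply: subset_trans subPX; apply/bigcupsP => A QA; apply: bigcup_sup (subsetP subQP A QA).
- rewrite (card_uniform_partition (n := m) (P := Q)) ?cardQ 1?mulnC //.
    by move=> A /(subsetP subQP) /allP[].
  rewrite /partition eqxx tiQ; apply/negP => /(subsetP subQP)/allP[].
  by rewrite cards0 => m0; rewrite -m0 in m_gt0.
- by apply: (pm_zero_cover (f := f) _ _ zQ) => // A /(subsetP subQP) /fP.
Qed.

(** Passing to the subtype of an [m]-element subset of [X] makes all of [I] available, since
    [chevalley] counts variables by a type. *)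
Lemma pm_forces_type n m :
    (forall (I : finType) (g : I -> bool -> int), #|I| = m ->
      exists D : {set I}, #|D| = n /\ pm_zero n g D) ->
  pm_forces n m.
Proof.
move=> forces I g X /subset_of_card[Y subYX cardY].
have [|D [cardD [f zD]]] := forces {i | i \in Y} (fun i => g (val i)).
  by rewrite card_sig cardY.
exists (val @: D); split.
- apply: subset_trans subYX; apply/subsetP => _ /imsetP[i _ ->]; exact: valP.
- by rewrite card_imset //; apply: val_inj.
exists (fun i => oapp f false (insub i)) => c.
rewrite big_imset /= => [|i j _ _]; last exact: val_inj.
by rewrite (eq_bigr (fun i => (-1) ^+ f i * g (val i) c)) // => i _; rewrite valK.
Qed.

(** * Odd moduli *)

Lemma pm_forces_prime p : prime p -> odd p -> pm_forces p (p + p.-1).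
Proof.
move=> pr_p odd_p; apply: pm_forces_type => I g cardI.
have p_gt1 := prime_gt1 pr_p.
pose h := p.-1./2; have def_h : (h + h = p.-1)%N.
  move: odd_p; rewrite addnn -[RHS]odd_double_half -{1}(prednK (prime_gt0 pr_p)) /=.
  by move=> /negPf ->.
have h_gt0 : (0 < h)%N.
  by move: odd_p p_gt1; rewrite -(prednK (prime_gt0 pr_p)) -def_h; case: (h) => [|[]].
(* The index [None] is for the form that measures the support. The degrees add up to [h + h + p.-1],
   that is 2p-2, one less than the number of variables. *)
pose F (j : option bool) (x : {ffun I -> 'F_p}) : 'F_p :=
  if j is Some c then \sum_i (g i c)%:~R * x i ^+ h else \sum_i 1 * x i ^+ p.-1.
pose d (j : option bool) := if j is Some c then h else p.-1.
have [j|||x x_neq0 Fx0] := @chevalley _ I _ d F.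
- by case: j => [c|]; apply: deg_le_sum => i; apply: deg_le_scale_expr.
- rewrite cardI (bigD1 None) //= (bigD1 (Some true)) //= (bigD1 (Some false)) //=.
  rewrite big1 ?addn0 ?def_h => [|[[]|]] //.
  by move: p_gt1; clear; lia.
- by case=> [c|] /=; rewrite big1 // => i _; rewrite ffunE expr0n gtn_eqF ?mulr0 //;
    move: p_gt1; clear; lia.
have expfp (y : 'F_p) : y != 0 -> y ^+ p.-1 = 1.
  move=> y_neq0; apply: (mulfI y_neq0); rewrite -exprS prednK ?prime_gt0 //.
  by have := expf_card y; rewrite card_Fp // mulr1.
(* The form [None] equals [#|D|] in ['F_p], so [p] divides [#|D|]; as 0 < [#|D|] < 2p, the support
   has exactly [p] elements. *)
pose D := [set i | x i != 0]; exists D; split.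
  have : (p %| #|D|)%N.
    have := Fx0 None; rewrite /= (bigID [in D]) /= [X in _ + X]big1 => [|i]; last first.
      rewrite inE negbK => /eqP ->; rewrite expr0n gtn_eqF ?mulr0 //.
      by move: p_gt1; clear; lia.
    rewrite addr0 (eq_bigr (fun=> 1)) => [|i]; last first.
      by rewrite inE mul1r => /expfp.
    by rewrite sumr_const => /eqP; rewrite -(dvdn_pcharf (pchar_Fp pr_p)).
  have D_gt0 : (0 < #|D|)%N.
    rewrite card_gt0; apply: contraNneq x_neq0 => D0; apply/eqP/ffunP => i.
    by rewrite ffunE; apply/eqP; move/setP/(_ i): D0; rewrite !inE => /negbFE.
  have D_lt : (#|D| < p * 2)%N.
    by apply: leq_ltn_trans (max_card _) _; rewrite cardI; move: p_gt1; clear; lia.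
  case/dvdnP=> q cardD; move: D_gt0 D_lt; rewrite cardD mulnC muln_gt0 ltn_pmul2l ?(prime_gt0 pr_p) //=.
  by case: (q) => [|[|?]]; rewrite ?andbF ?muln1.
(* On [D] the square of [x i ^+ h] is 1, so this power is 1 or -1 and the boolean records which. *)
exists (fun i => x i ^+ h != 1) => c.
rewrite (dvdz_pcharf (pchar_Fp pr_p)) rmorph_sum /=; apply/eqP.
rewrite -[RHS](Fx0 (Some c)) /= [RHS](bigID [in D]) /= [X in _ + X]big1 => [|i].
  rewrite addr0; apply: eq_bigr => i; rewrite inE => /expfp xi.
  rewrite rmorphM rmorph_sign mulrC; congr (_ * _).
  have /eqP := xi; rewrite -def_h exprD -expr2 sqrf_eq1.
  by case: eqP => [-> //|_ /eqP ->].
by rewrite inE negbK => /eqP ->; rewrite expr0n gtn_eqF ?mulr0.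
Qed.

Lemma pm_forces_odd n : odd n -> pm_forces n (n + n.-1).
Proof.
elim/ltn_ind: n => n IHn odd_n.
have [n_le1|n_gt1] := leqP n 1.
  have -> : n = 1%N by case: n odd_n n_le1 {IHn} => [|[]].
  move=> I g X /card_gt0P[i Xi]; exists [set i].
  by rewrite sub1set Xi cards1; split=> //; exists (fun=> false) => c; apply: dvd1z.
have pr_p := pdiv_prime n_gt1; have p_gt0 := prime_gt0 pr_p.
case/dvdnP: (pdiv_dvd n) => k def_n.
move: odd_n; rewrite def_n oddM => /andP[odd_k odd_p].
have lt_kn : (k < n)%N.
  by rewrite [ltnRHS]def_n ltn_Pmulr ?prime_gt1 // odd_gt0.
(* For n = pk the count is p(2k-2) + 2p-1 = 2n-1, so the bound reproduces itself. *)
have := pm_forces_mul p_gt0 (pm_forces_prime pr_p odd_p) (IHn k lt_kn odd_k).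
rewrite mulnC; apply: pm_forces_leq.
by case: (k) odd_k => //= k' _; move: p_gt0; clear; lia.
Qed.

(** * Subsets of equal residue, and Plotkin's bound *)

Lemma pigeonhole (aT rT : finType) (h : aT -> rT) (E : {set aT}) r :
  (#|rT| * r < #|E|)%N -> exists y, (r < #|[set x in E | h x == y]|)%N.
Proof.
move=> lt_E; apply/existsP; apply: contraLR lt_E => /existsPn le_r.
rewrite -leqNgt -sum1_card (partition_big h predT) //= -sum_nat_const.
apply: leq_sum => y _; rewrite sum1dep_card leqNgt; apply: contra (le_r y).
by rewrite !cardE.
Qed.

Lemma cardsU_disjoint (T : finType) (A B : {set T}) :
  [disjoint A & B] -> #|A :|: B| = (#|A| + #|B|)%N.
Proof. by move/disjoint_setI0=> AB0; rewrite cardsU AB0 cards0 subn0. Qed.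

Definition symdiff (T : finType) (A B : {set T}) := (A :\: B) :|: (B :\: A).

Lemma in_symdiff (T : finType) (A B : {set T}) x :
  (x \in symdiff A B) = (x \in A) (+) (x \in B).
Proof. by rewrite !inE; do 2!case: (x \in _). Qed.

Lemma symdiff_eq0 (T : finType) (A B : {set T}) : (symdiff A B == set0) = (A == B).
Proof.
apply/eqP/eqP=> [/setP AB0 | ->]; apply/setP=> x.
  by move: (AB0 x); rewrite in_symdiff inE; do 2!case: (x \in _).
by rewrite in_symdiff inE addbb.
Qed.

Lemma odd_card_symdiff (T : finType) (A B : {set T}) :
  odd #|symdiff A B| = odd #|A| (+) odd #|B|.
Proof.
rewrite cardsU_disjoint; last first.
  by rewrite -setI_eq0; apply/eqP/setP => x; rewrite !inE; do 2!case: (x \in _).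
rewrite -(cardsID B A) -(cardsID A B) [B :&: A]setIC !oddD.
by do 3!case: (odd _).
Qed.

(** The finite codomain is what [pigeonhole] needs. For positive [n] the remainder lies in [0, n),
    so neither the absolute value nor [inord] loses information. *)
Definition residue n (I : finType) (g : I -> bool -> int) (A : {set I}) :
    {ffun bool -> 'I_n.-1.+1} :=
  [ffun c => inord `|((\sum_(i in A) g i c) %% n)%Z|%N].

(** Subtracting the two sums cancels the common terms and leaves sign + on A minus B and sign - on B
    minus A. *)
Lemma pm_zero_symdiff n (I : finType) (g : I -> bool -> int) (A B : {set I}) :
  (0 < n)%N -> residue n g A = residue n g B -> pm_zero n g (symdiff A B).
Proof.
move=> n_gt0 eq_res; exists (fun i => i \notin A) => c.
have res_lt (C : {set I}) : (`|((\sum_(i in C) g i c) %% n)%Z| < n.-1.+1)%N.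
  have n_neq0 : n%:Z != 0 by rewrite -lt0n.
  rewrite prednK // -ltz_nat (gez0_abs (modz_ge0 _ n_neq0)).
  exact: lt_le_trans (ltz_mod _ n_neq0) _.
have eq_mod : ((\sum_(i in A) g i c) = (\sum_(i in B) g i c) %[mod n])%Z.
  have n_neq0 : n%:Z != 0 by rewrite -lt0n.
  move/ffunP/(_ c)/(congr1 val): eq_res; rewrite !ffunE /= !inordK //.
  by move/(congr1 Posz); rewrite !gez0_abs ?modz_ge0.
move/eqP: eq_mod; rewrite eqz_mod_dvd; congr (_ %| _)%Z.
rewrite !(big_mkcond (fun i => i \in _)) -sumrB; apply: eq_bigr => i _.
rewrite in_symdiff; case: (i \in A); case: (i \in B) => //=;
  by rewrite ?expr0 ?expr1 ?mul1r ?mulN1r ?subrr ?subr0 ?sub0r.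
Qed.

(** The subsets of [X] are sorted by parity and residue into 2n^2 classes; equal parity makes the
    symmetric differences even. *)
Lemma even_fibre n (I : finType) (g : I -> bool -> int) (X : {set I}) r :
    (0 < n)%N -> (2 * n ^ 2 * r < 2 ^ #|X|)%N ->
  exists F : {set {set I}}, (r < #|F|)%N /\
    forall A B, A \in F -> B \in F ->
      [/\ A \subset X, ~~ odd #|symdiff A B| & pm_zero n g (symdiff A B)].
Proof.
move=> n_gt0; rewrite -card_powerset => lt_r.
have [|y lt_F] := @pigeonhole _ _ (fun A : {set I} => (odd #|A|, residue n g A))
  (powerset X) r.
  by rewrite card_prod card_bool card_ffun card_bool card_ord prednK.
eexists; split; first exact: lt_F.
move=> A B; rewrite !inE => /andP[subAX /eqP defA] /andP[_ /eqP].
rewrite -defA => -[oddAB resAB]; split=> //; first by rewrite odd_card_symdiff oddAB addbb.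
exact: pm_zero_symdiff.
Qed.

(* Plotkin's bound for a code F of length #|X| and minimum distance d. *)
Lemma plotkin (I : finType) (X : {set I}) (F : {set {set I}}) (d : nat) :
    {in F, forall A : {set I}, A \subset X} ->
    {in F &, forall A B : {set I}, A != B -> (d <= #|symdiff A B|)%N} ->
  (2 * d * #|F|.-1 <= #|X| * #|F|)%N.
Proof.
move=> subFX dF; pose M := #|F|.
have [M0|M_gt0] := posnP M; first by rewrite -/M M0 /= !muln0.
(* Distances are summed over ordered pairs: each of the M(M-1) pairs of distinct members contributes
   at least [d]. *)
have lower : (M * (M.-1 * d) <= \sum_(A in F) \sum_(B in F) #|symdiff A B|)%N.
  rewrite -sum_nat_const leq_sum // => A FA.
  rewrite (bigD1 A) //= -[leqLHS]add0n leq_add //.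
  rewrite /M (cardsD1 A) FA /= -sum_nat_const big_mkcond [leqRHS]big_mkcond leq_sum // => B _.
  rewrite !inE andbC; case: ifP => // /andP[FB neqBA].
  by rewrite dF // eq_sym.
have upper : (2 * (\sum_(A in F) \sum_(B in F) #|symdiff A B|) <= #|X| * M ^ 2)%N.
  have -> : (\sum_(A in F) \sum_(B in F) #|symdiff A B| =
      \sum_(i in X) \sum_(A in F) \sum_(B in F) (i \in symdiff A B))%N.
    rewrite [RHS]exchange_big; apply: eq_bigr => A FA.
    rewrite [RHS]exchange_big; apply: eq_bigr => B FB.
    rewrite -sum1_card big_mkcond [RHS]big_mkcond; apply: eq_bigr => i _.
    case: (boolP (i \in X)) => [_|notXi]; first by case: (i \in _).
    have notin C : C \in F -> (i \in C) = false.
      by move=> FC; apply: contraNF notXi; apply: subsetP (subFX C FC) i.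
    by rewrite in_symdiff !notin.
  rewrite big_distrr -sum_nat_const leq_sum // => i _.
  (* The point [i] separates 2kl ordered pairs, and 4kl is at most (k+l)^2 = M^2. *)
  pose k := #|[set A in F | i \in A]|; pose l := #|[set A in F | i \notin A]|.
  have sum_in A : A \in F ->
      (\sum_(B in F) (i \in symdiff A B) = if i \in A then l else k)%N.
    by move=> _; case: ifP => iA; rewrite /k /l -sum1_card big_mkcond [RHS]big_mkcond;
      apply: eq_bigr => B _; rewrite in_symdiff !inE iA; case: (B \in F); case: (i \in B).
  rewrite (eq_bigr _ sum_in) (bigID (fun A : {set I} => i \in A)) /=.
  rewrite (eq_bigr (fun=> l)) => [|A /andP[_ ->] //].
  rewrite [X in (_ + X)%N](eq_bigr (fun=> k)) => [|A /andP[_ /negPf ->] //].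
  rewrite !sum_nat_cond_const.
  have kE : #|[set A | A \in F & i \in A]| = k by [].
  have lE : #|[set A | A \in F & i \notin A]| = l by [].
  have -> : M = (k + l)%N.
    rewrite /M -(cardsID [set A : {set I} | i \in A] F); congr (_ + _)%N; apply: eq_card => A;
      by rewrite !inE // andbC.
  rewrite kE lE; have [AGM _] := nat_AGM2 k l.
  by apply: leq_trans AGM; clear; lia.
rewrite -/M -(leq_pmul2l M_gt0); nia.
Qed.

(** * Moduli 2 and 8 *)

(** Two of five terms agree modulo 2, and their difference is the required sum. *)
Lemma pm_forces_2 : pm_forces 2 5.
Proof.
move=> I g X le_X.
have [|y /card_gt1P[i [j []]]] := @pigeonhole _ _ (fun i => residue 2 g [set i]) X 1.
  by rewrite card_ffun card_bool card_ord muln1.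
rewrite !inE => /andP[Xi /eqP <-] /andP[Xj /eqP eq_ij] neq_ij.
exists [set i; j]; split; first by rewrite subUset !sub1set Xi.
  by rewrite cards2 neq_ij.
have -> : [set i; j] = symdiff [set i] [set j].
  apply/setP => k; rewrite in_symdiff !inE.
  by have [->|] := eqVneq k i; rewrite ?(negPf neq_ij) //.
by apply: pm_zero_symdiff; rewrite ?eq_ij.
Qed.

(** There are 256 subsets and only 128 classes, so two distinct subsets share a class. *)
Lemma pm_zero_8 (I : finType) (g : I -> bool -> int) (X : {set I}) :
  (8 <= #|X|)%N ->
  exists D : {set I}, [/\ D \subset X, #|D| \in [:: 2; 4; 6; 8]%N & pm_zero 8 g D].
Proof.
case/subset_of_card=> Y subYX cardY.
have [//||F [/card_gt1P[A [B [FA FB neqAB]]] propF]] := @even_fibre 8 _ g Y 1.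
  by rewrite cardY.
have [subAY even_D zD] := propF A B FA FB; have [subBY _ _] := propF B A FB FA.
have subDY : symdiff A B \subset Y.
  by rewrite subUset (subset_trans (subsetDl _ _)) // (subset_trans (subsetDl _ _)).
exists (symdiff A B); split=> //; first exact: subset_trans subYX.
have := subset_leq_card subDY; move: even_D; rewrite cardY.
rewrite -symdiff_eq0 -cards_eq0 in neqAB.
by case: #|_| neqAB => [|[|[|[|[|[|[|[|[|?]]]]]]]]].
Qed.

Lemma pm_zero_10 (I : finType) (g : I -> bool -> int) (X : {set I}) :
  (10 <= #|X|)%N ->
  exists D : {set I}, [/\ D \subset X, #|D| \in [:: 2; 4; 8]%N & pm_zero 8 g D].
Proof.
case/subset_of_card=> Y subYX cardY.
(* Since 128 * 7 = 896 < 1024, some class has at least 8 members. *)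
have [//||F [lt_F propF]] := @even_fibre 8 _ g Y 7.
  by rewrite cardY.
have [/exists_inP[A FA /exists_inP[B FB cardD]]|/exists_inPn noD] :=
    boolP [exists A in F, [exists B in F, #|symdiff A B| \in [:: 2; 4; 8]%N]].
  have [subAY _ zD] := propF A B FA FB; have [subBY _ _] := propF B A FB FA.
  exists (symdiff A B); split=> //; apply: subset_trans subYX.
  by rewrite subUset (subset_trans (subsetDl _ _)) // (subset_trans (subsetDl _ _)).
(* The remaining even distances are 6 and 10, so Plotkin's bound with d = 6 gives 12(M-1) <= 10M,
   that is M <= 6. *)
suff : (2 * 6 * #|F|.-1 <= #|Y| * #|F|)%N by rewrite cardY; move: lt_F; clear; lia.
apply: plotkin => [A FA|A B FA FB neqAB]; first by have [] := propF A A FA FA.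
have [_ even_D _] := propF A B FA FB.
have /exists_inPn/(_ B FB) := noD A FA.
rewrite -symdiff_eq0 -cards_eq0 in neqAB; move: neqAB even_D.
by case: #|_| => [|[|[|[|[|[|?]]]]]].
Qed.

(** Lengths 2, 4 or 8 can be extracted while ten terms remain, and a length among 2, 4, 6, 8 while
    eight remain; the extraction goes on until some of the lengths add up to 8. *)
Lemma pm_forces_8 : pm_forces 8 14.
Proof.
move=> I g X le_X.
pose zs (k : nat) (D : {set I}) := #|D| = k /\ pm_zero 8 g D.
have zsU (A B : {set I}) k l : [disjoint A & B] -> zs k A -> zs l B -> zs (k + l)%N (A :|: B).
  move=> disAB [cA zA] [cB zB]; split; last exact: pm_zero_setU.
  by rewrite cardsU_disjoint ?cA ?cB.
suff [D [subDX [cD zD]]] : exists D : {set I}, D \subset X /\ zs 8 D by exists D.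
have find8 (Y : {set I}) : Y \subset X -> (#|Y| + 8 <= #|X|)%N -> exists D : {set I},
    [/\ D \subset X, [disjoint Y & D] & [\/ zs 2 D, zs 4 D, zs 6 D | zs 8 D]]%N.
  move=> subYX leYX; have [|D [subD cardD zD]] := @pm_zero_8 I g (X :\: Y).
    by rewrite cardsD (setIidPr subYX) leq_subRL ?subset_leq_card.
  move: subD; rewrite subsetD disjoint_sym => /andP[subDX disYD]; exists D; split=> //.
  by move: cardD; rewrite !inE /zs => /or4P[] /eqP ->;
    [constructor 1 | constructor 2 | constructor 3 | constructor 4].
have find10 (Y : {set I}) : Y \subset X -> (#|Y| + 10 <= #|X|)%N -> exists D : {set I},
    [/\ D \subset X, [disjoint Y & D] & [\/ zs 2 D, zs 4 D | zs 8 D]]%N.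
  move=> subYX leYX; have [|D [subD cardD zD]] := @pm_zero_10 I g (X :\: Y).
    by rewrite cardsD (setIidPr subYX) leq_subRL ?subset_leq_card.
  move: subD; rewrite subsetD disjoint_sym => /andP[subDX disYD]; exists D; split=> //.
  by move: cardD; rewrite !inE /zs => /or3P[] /eqP ->;
    [constructor 1 | constructor 2 | constructor 3].
(* Eight terms lie outside [A :|: B]. Whatever even length [C] has, 8 is reached as 4+2+2, 4+4, 2+6
   or 8. *)
have case42 (A B : {set I}) : A \subset X -> B \subset X -> [disjoint A & B] -> zs 4 A -> zs 2 B ->
    exists D : {set I}, D \subset X /\ zs 8 D.
  move=> AX BX disAB zA zB; have zAB := zsU _ _ _ _ disAB zA zB.
  have [||C [CX]] := find8 (A :|: B); rewrite ?subUset ?AX ?zAB.1 //.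
  rewrite disjoints_subset subUset -!disjoints_subset => /andP[disAC disBC].
  case=> zC.
  - exists (A :|: B :|: C); split; first by rewrite !subUset AX BX.
    by apply: (zsU _ _ 6 2) => //; rewrite disjoints_subset subUset -!disjoints_subset disAC.
  - by exists (A :|: C); split; [rewrite subUset AX | apply: (zsU _ _ 4 4)].
  - by exists (B :|: C); split; [rewrite subUset BX | apply: (zsU _ _ 2 6)].
  - by exists C.
have [||A [AX _ zA]] := find10 set0; rewrite ?sub0set ?cards0 //.
  exact: (leq_trans _ le_X).
have [zA2|zA4|zA8] := zA; last by exists A.
  have [||B [BX disAB zB]] := find10 A; rewrite ?zA2.1 //; first exact: (leq_trans _ le_X).
  have [zB2|zB4|zB8] := zB; last by exists B.
    have zAB := zsU _ _ _ _ disAB zA2 zB2.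
    have [||C [CX]] := find10 (A :|: B); rewrite ?subUset ?AX ?zAB.1 //.
    rewrite disjoints_subset subUset -!disjoints_subset => /andP[disAC disBC].
    have disABC : [disjoint A :|: B & C].
      by rewrite disjoints_subset subUset -!disjoints_subset disAC.
    case=> zC; last by exists C.
      have zABC := zsU _ _ _ _ disABC zAB zC.
      (* Three zero-sums of length 2 leave eight terms, and 8 is reached as 6+2, 4+4, 2+6 or 8. *)
      have [||D [DX]] := find8 (A :|: B :|: C); rewrite ?subUset ?AX ?BX ?zABC.1 //.
      rewrite disjoints_subset !subUset -!disjoints_subset => /andP[/andP[disAD disBD] disCD].
      case=> zD; last by exists D.
      - exists (A :|: B :|: C :|: D); split; first by rewrite !subUset AX BX CX.
        apply: (zsU _ _ 6 2) => //.
        by rewrite disjoints_subset !subUset -!disjoints_subset disAD disBD.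
      - exists (A :|: B :|: D); split; first by rewrite !subUset AX BX.
        by apply: (zsU _ _ 4 4) => //; rewrite disjoints_subset subUset -!disjoints_subset disAD.
      - by exists (A :|: D); split; [rewrite subUset AX | apply: (zsU _ _ 2 6)].
    by exists (A :|: B :|: C); split; [rewrite !subUset AX BX | apply: (zsU _ _ 4 4)].
  by apply: (case42 B A) => //; rewrite disjoint_sym.
have [||B [BX disAB zB]] := find10 A; rewrite ?zA4.1 //.
case: zB => zB; last by exists B.
  exact: (case42 A B).
by exists (A :|: B); split; [rewrite subUset AX | apply: (zsU _ _ 4 4)].
Qed.

(** * Deciding the existence of signed zero-sums *)

(** This test serves both the search for n = 4 and the lower bounds; [a] accumulates the signed sum
    of the terms already chosen. *)
Fixpoint signed_zero (G : zmodType) (k : nat) (a : G) (s : seq G) : bool :=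
  match k, s with
  | 0, _ => a == 0
  | _, [::] => false
  | k'.+1, x :: s' =>
      if signed_zero k' (a + x) s' then true else
      if signed_zero k' (a - x) s' then true else signed_zero k a s'
  end.

Lemma signed_zero_cons (G : zmodType) k (a x : G) s :
  signed_zero k.+1 a (x :: s) =
    [|| signed_zero k (a + x) s, signed_zero k (a - x) s | signed_zero k.+1 a s].
Proof. by []. Qed.

(** Labels in [T] keep equal values apart, so that the solution found yields a set of indices. *)
Lemma signed_zero_sound (G : zmodType) (T : eqType) (v : T -> G) k a (s : seq T) :
    uniq s -> signed_zero k a (map v s) ->
  exists (t : seq T) (f : T -> bool),
    [/\ subseq t s, size t = k & a + \sum_(i <- t) (if f i then - v i else v i) = 0].
Proof.
elim: s k a => [|x s IHs] [|k] a //.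
- by move=> _ /eqP /= ->; exists [::], (fun=> false); rewrite big_nil addr0.
- by move=> _ /eqP /= ->; exists [::], (fun=> false); rewrite big_nil addr0.
rewrite cons_uniq => /andP[notsx uniq_s].
have extend e t f : subseq t s -> size t = k ->
    a + (if e then - v x else v x) + \sum_(i <- t) (if f i then - v i else v i) = 0 ->
  exists (t : seq T) (f : T -> bool),
    [/\ subseq t (x :: s), size t = k.+1
      & a + \sum_(i <- t) (if f i then - v i else v i) = 0].
  move=> sub_ts size_t sum0; exists (x :: t), (fun i => if i == x then e else f i).
  rewrite /= eqxx size_t big_cons eqxx addrA; split=> //.
  rewrite -[RHS]sum0; congr (_ + _); apply: eq_big_seq => i ti.
  by case: eqP => // eq_ix; rewrite -eq_ix (mem_subseq sub_ts ti) in notsx.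
rewrite [map _ _]/= signed_zero_cons => /or3P[] /IHs[] // t [f [sub_ts size_t sum0]].
- exact: (extend false t f).
- exact: (extend true t f).
- by exists t, f; split=> //; apply: subseq_trans sub_ts (subseq_cons _ _).
Qed.

Lemma signed_zero_complete (G : zmodType) (a : G) (s t : seq G) (eps : nat -> int) :
    subseq t s -> (forall i, (i < size t)%N -> eps i = 1 \/ eps i = -1) ->
    a + \sum_(i < size t) t`_i *~ eps i = 0 ->
  signed_zero (size t) a s.
Proof.
elim: s t a eps => [|x s IHs] [|y t] a eps //.
- by rewrite big_ord0 addr0 /= => _ _ ->.
- by rewrite big_ord0 addr0 /= => _ _ ->.
rewrite [size _]/= signed_zero_cons [subseq _ _]/=.
case: eqP => [-> | _] sub_ts eps1 sum0; last by rewrite (IHs (y :: t) a eps) ?orbT.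
rewrite big_ord_recl /= addrA in sum0.
have {}IHs b : b + \sum_(i < size t) t`_i *~ eps i.+1 = 0 -> signed_zero (size t) b s.
  by apply: (IHs t b (fun i => eps i.+1)) => // i lt_i; apply: eps1.
have [eps0|eps0] := eps1 0%N isT; rewrite eps0 ?mulrN1z ?mulr1z in sum0.
  by rewrite IHs.
by rewrite orbC -orbA IHs ?orbT.
Qed.

(* Every multiset extending pre by m terms taken from cs has a signed zero-sum
   submultiset of k.+1 terms not contained in pre; terms are tried in the order
   of cs, so that each multiset is visited once.  The conditionals, unlike
   boolean connectives, prune the search under call-by-value evaluation. *)
Fixpoint all_signed_zero (G : zmodType) (k m : nat) : seq G -> seq G -> bool :=
  match m with
  | 0 => fun _ _ => false
  | m'.+1 => fix loop cs pre :=
      if cs is c :: cs' then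
        if (if signed_zero k c pre then true
            else all_signed_zero k m' cs (c :: pre))
        then loop cs' pre else false
      else true
  end.

Lemma all_signed_zeroP (G : zmodType) (T : eqType) (v : T -> G) k m cs (pre w : seq T) :
    all_signed_zero k m cs (map v pre) -> {in w, forall i, v i \in cs} ->
    size w = m -> uniq (pre ++ w) ->
  exists (t : seq T) (f : T -> bool), [/\ uniq t, {subset t <= pre ++ w}, size t = k.+1
    & \sum_(i <- t) (if f i then - v i else v i) = 0].
Proof.
elim: m cs pre w => // m IHm.
elim=> [|c cs IHcs] pre w.
  by move=> _; case: w => // i w /(_ i); rewrite mem_head => /(_ isT).
move=> /= all_c w_cs size_w uniq_w.
(* If [c] is a value on [w], one such label moves to [pre] and [c] stays a candidate, as it may
   recur; otherwise [c] is dropped. *)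
have [/hasP[i wi /eqP def_c]|/hasPn notc] := boolP (has (fun i => v i == c) w).
  have perm_w : perm_eq (pre ++ w) ((i :: pre) ++ rem i w).
    by rewrite (perm_catl _ (perm_to_rem wi)) -cat1s perm_catCA.
  have uniq_iw : uniq ((i :: pre) ++ rem i w) by rewrite -(perm_uniq perm_w).
  suff [t [f [uniq_t sub_t size_t sum0]]] : exists (t : seq T) (f : T -> bool),
      [/\ uniq t, {subset t <= (i :: pre) ++ rem i w}, size t = k.+1
        & \sum_(i <- t) (if f i then - v i else v i) = 0].
    by exists t, f; split=> // j /sub_t; rewrite (perm_mem perm_w).
  have [zc|/negPf nzc] := boolP (signed_zero k c (map v pre)).
    have uniq_ipre : uniq (i :: pre) by move: uniq_iw; rewrite cat_uniq => /andP[].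
    have [|t [f [sub_t size_t]]] := @signed_zero_sound _ _ v k.+1 0 _ uniq_ipre.
      by rewrite [map _ _]/= signed_zero_cons def_c add0r zc.
    rewrite add0r => sum0; exists t, f; split=> //; first exact: subseq_uniq sub_t uniq_ipre.
    by move=> j /(mem_subseq sub_t) pj; rewrite mem_cat pj.
  rewrite nzc in all_c; apply: (IHm (c :: cs)) => //.
  - by rewrite /= def_c; case: ifP all_c.
  - by move=> j /mem_rem; apply: w_cs.
  - by rewrite size_rem // size_w.
apply: IHcs => // [|i wi]; first by case: ifP all_c.
by have := w_cs i wi; rewrite inE (negPf (notc i wi)).
Qed.

(** * The group [Zn2 n], and modulus 4 *)

(** Reduction modulo [n] is written with integer multiples of [inZp 1], using only the additive
    group, so that n = 1 is covered. *)
Definition Zn2_of n (z : bool -> int) : Zn2 n :=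
  ((inZp 1 : 'I_n.-1.+1) *~ z true, (inZp 1 : 'I_n.-1.+1) *~ z false).

Lemma inZp1_mulz_eq0 p (z : int) :
  ((inZp 1 : 'I_p.+1) *~ z == 0) = (p.+1 %| z)%Z.
Proof.
have natE k : ((inZp 1 : 'I_p.+1) *+ k == 0) = (p.+1 %| k)%N.
  by rewrite Zp_mulrn -val_eqE /= modnMml mul1n.
by case: z => k; rewrite ?NegzE ?mulrNz ?oppr_eq0 natE dvdzE ?abszN.
Qed.

Lemma inZp1_mulz_nat p (x : 'I_p.+1) : (inZp 1 : 'I_p.+1) *~ (x : nat) = x.
Proof.
rewrite -pmulrn Zp_mulrn; apply: val_inj.
by rewrite /= modnMml mul1n modn_small.
Qed.

Lemma fst_mulz (A B : zmodType) (x : A * B) (z : int) : (x *~ z).1 = x.1 *~ z.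
Proof. exact: (raddfMz (@fst A B)). Qed.

Lemma snd_mulz (A B : zmodType) (x : A * B) (z : int) : (x *~ z).2 = x.2 *~ z.
Proof. exact: (raddfMz (@snd A B)). Qed.

Lemma sum_Zn2_of_eq0 n (T : Type) (r : seq T) (e : T -> int) (g : T -> bool -> int) :
    (0 < n)%N ->
  (\sum_(i <- r) Zn2_of n (g i) *~ e i == 0) <->
  (forall c, (n %| \sum_(i <- r) e i * g i c)%Z).
Proof.
move=> n_gt0; set S := \sum_(i <- r) _.
have S1 : S.1 = (inZp 1 : 'I_n.-1.+1) *~ (\sum_(i <- r) e i * g i true).
  rewrite /S (raddf_sum (@fst _ _)) mulrz_sumr.
  by apply: eq_bigr => i _; rewrite mulrC mulrzA; apply: etrans (fst_mulz _ _) _.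
have S2 : S.2 = (inZp 1 : 'I_n.-1.+1) *~ (\sum_(i <- r) e i * g i false).
  rewrite /S (raddf_sum (@snd _ _)) mulrz_sumr.
  by apply: eq_bigr => i _; rewrite mulrC mulrzA; apply: etrans (snd_mulz _ _) _.
have -> : (S == 0) = (S.1 == 0) && (S.2 == 0) by [].
rewrite S1 S2 !inZp1_mulz_eq0 prednK //; split=> [/andP[n1 n2] [] //|nS].
by rewrite !nS.
Qed.

(* One representative for each pair of opposite elements. *)
Definition Zn2_4_mod_sign : seq (Zn2 4) :=
  [seq (inZp u.1, inZp u.2) | u <- [:: (0, 0); (0, 1); (0, 2); (1, 0); (1, 1);
    (1, 2); (1, 3); (2, 0); (2, 1); (2, 2)]%N].

Lemma Zn2_4_mod_signP (x : Zn2 4) :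
  (x \in Zn2_4_mod_sign) || (- x \in Zn2_4_mod_sign).
Proof.
by case: x => [[[|[|[|[|?]]]] ?] [[|[|[|[|?]]]] ?]].
Qed.

(** The argument 3 encodes zero-sums of length 4, and 8 is the length of the sequences searched. *)
Lemma all_signed_zero_Zn2_4 : all_signed_zero 3 8 Zn2_4_mod_sign [::].
Proof. by vm_compute. Qed.

Lemma pm_forces_4 : pm_forces 4 8.
Proof.
move=> I g X /subset_of_card[Y subYX cardY].
(* Replacing a term by its opposite only changes its sign in a solution, so every term may be taken
   among the ten representatives. *)
pose flip i := Zn2_of 4 (g i) \notin Zn2_4_mod_sign.
pose v i := if flip i then - Zn2_of 4 (g i) else Zn2_of 4 (g i).
have [|||t [f [uniq_t sub_t size_t sum0]]] :=
  @all_signed_zeroP _ _ v 3 8 Zn2_4_mod_sign [::] (enum Y) all_signed_zero_Zn2_4.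
- move=> i _; rewrite /v /flip; have := Zn2_4_mod_signP (Zn2_of 4 (g i)).
  by case: ifP => [/negPf ->|/negbFE].
- by rewrite -cardE.
- exact: enum_uniq.
exists [set i in t]; split.
- by apply: subset_trans subYX; apply/subsetP => i; rewrite inE => /sub_t; rewrite mem_enum.
- by rewrite cardsE -size_t; apply/card_uniqP.
exists (fun i => f i (+) flip i) => c.
rewrite (eq_bigl [in t]) => [|i]; last by rewrite inE.
rewrite -big_uniq //; move: c; apply/(@sum_Zn2_of_eq0 4 _ t (fun i => (-1) ^+ (f i (+) flip i))) => //.
apply/eqP; rewrite -[RHS]sum0; apply: eq_bigr => i _; rewrite /v.
by case: (f i); case: (flip i); rewrite ?mulr1z ?mulrN1z ?opprK.
Qed.

(** * Upper and lower bounds for [s_pm] *)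

Lemma pm_zero_sum_map (G : zmodType) (T : Type) (r : seq T) (v : T -> G) (e : T -> int) :
    (forall x, e x = 1 \/ e x = -1) -> \sum_(x <- r) v x *~ e x = 0 ->
  pm_zero_sum (map v r).
Proof.
case: r => [|x0 r] e1 sum0; first by exists (fun=> 1); rewrite big_ord0; split; [left|].
exists (fun i => e (nth x0 (x0 :: r) i)); split=> //.
rewrite -(big_mkord xpredT (fun i => (map v (x0 :: r))`_i *~ e (nth x0 (x0 :: r) i))).
rewrite size_map -[RHS]sum0 (big_nth x0) big_nat [RHS]big_nat.
by apply: eq_bigr => i /andP[_ lt_i]; rewrite (nth_map x0).
Qed.

Lemma exponent_Zn2 n : (0 < n)%N -> exponent [set: Zn2 n] = n.
Proof.
move=> n_gt0; apply/eqP; rewrite eqn_dvd; apply/andP; split.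
  have mulrn0 (y : 'I_n.-1.+1) : y *+ n = 0.
    by rewrite Zp_mulrn; apply: val_inj; case: n n_gt0 y => // p _ y; rewrite /= modnMl.
  apply/exponentP => x _; rewrite FinRing.zmodXgE.
  have: (x *+ n).1 = 0 /\ (x *+ n).2 = 0.
    by split; [have := raddfMn (@fst 'I_n.-1.+1 'I_n.-1.+1) n x
              | have := raddfMn (@snd 'I_n.-1.+1 'I_n.-1.+1) n x]; rewrite mulrn0.
  by case: (x *+ n) => x1 x2 /= [-> ->].
have := expg_exponent (in_setT ((inZp 1, 0) : Zn2 n)); rewrite FinRing.zmodXgE.
move/(congr1 fst); set e := exponent _ => eq0.
have : (inZp 1 : 'I_n.-1.+1) *~ e == 0.
  rewrite -pmulrn; apply/eqP/(etrans (esym _) eq0).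
  exact: (raddfMn (@fst 'I_n.-1.+1 'I_n.-1.+1) e).
by rewrite inZp1_mulz_eq0 prednK.
Qed.

Lemma s_pm_leq n m : (0 < n)%N -> pm_forces n m -> (s_pm (Zn2 n) <= m)%N.
Proof.
move=> n_gt0 forces; rewrite /s_pm; case: ex_minnP => k _; apply.
apply/boolp.asboolP => s le_s.
pose g (i : 'I_(size s)) (c : bool) : int := nat_of_ord (if c then (s`_i).1 else (s`_i).2).
have gE i : Zn2_of n (g i) = s`_i.
  by rewrite /Zn2_of /g !inZp1_mulz_nat; case: s`_i.
have [|D [_ cardD [f zD]]] := forces _ g setT; first by rewrite cardsT card_ord.
exists [seq s`_(val i) | i <- enum D]; split.
(* [enum D] lists positions in increasing order, which makes the chosen terms a subsequence. *)
- have sE : [seq s`_(val i) | i <- enum 'I_(size s)] = s.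
    by rewrite (map_comp (nth 0 s)) val_enum_ord -/(mkseq _ _) mkseq_nth.
  rewrite -[X in subseq _ X]sE map_subseq // {1}/enum_mem enumT.
  exact: filter_subseq.
- by rewrite size_map -cardE cardD exponent_Zn2.
apply: (@pm_zero_sum_map _ _ _ _ (fun i => (-1) ^+ f i)).
  by move=> i; case: (f i); [right | left].
under eq_bigr do rewrite -gE.
apply/eqP/sum_Zn2_of_eq0 => // c.
by rewrite big_enum.
Qed.

Lemma s_pm_gt (G : finZmodType) (s : seq G) :
  ~~ signed_zero (exponent [set: G]) 0 s -> (size s < s_pm G)%N.
Proof.
rewrite /s_pm; case: ex_minnP => m /boolp.asboolP bound_m _; rewrite ltnNge.
apply: contra => /bound_m[t [sub_ts <- [eps [eps1 sum0]]]].
apply: (@signed_zero_complete _ 0 s t (fun i => oapp eps 1 (insub i)) sub_ts).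
  by move=> i lt_i; rewrite insubT /=.
by rewrite add0r -[RHS]sum0; apply: eq_bigr => i _; rewrite valK.
Qed.

Lemma signed_zero_nseq0 (G : zmodType) k m (a : G) (s : seq G) :
    signed_zero k a (nseq m 0 ++ s) ->
  exists j, [/\ (j <= k)%N, (k <= m + j)%N & signed_zero j a s].
Proof.
elim: m k => [|m IHm] k; first by exists k.
case: k => [|k]; first by exists 0%N; split=> //; case: (s).
rewrite [_ ++ _]/= signed_zero_cons addr0 subr0 => /or3P[] /IHm[j [lejk lekj zj]];
  by exists j; split=> //; lia.
Qed.

(** Pad [s] with n-1 zeros: a zero-sum of length [n] would use at least one term of [s], and its
    part in [s] would be a zero-sum of length between 1 and [n]. *)
Lemma s_pm_Zn2_lower n (s : seq (Zn2 n)) :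
    (0 < n)%N -> ~~ has (fun k => signed_zero k 0 s) (iota 1 n) ->
  (n + size s <= s_pm (Zn2 n))%N.
Proof.
move=> n_gt0 /hasPn no_zero.
have -> : (n + size s = (size (nseq n.-1 (0%R : Zn2 n) ++ s)).+1)%N.
  by rewrite size_cat size_nseq -addSn prednK.
apply: s_pm_gt; rewrite exponent_Zn2 //; apply/negP => /signed_zero_nseq0[j [lejn lenj]].
by apply/negP/no_zero; rewrite mem_iota; lia.
Qed.

(** * Extremal sequences and assembly of the bounds *)

(** For n = 2^k, a nonempty signed sum of distinct powers 2^i with i < k is nonzero and below 2^k in
    absolute value, so no zero-sum occurs. The 2k terms give the lower bounds 4+4 and 8+6. *)
Definition powers_of_2 n k : seq (Zn2 n) :=
  [seq (inZp (2 ^ i), 0) | i <- iota 0 k] ++ [seq (0, inZp (2 ^ i)) | i <- iota 0 k].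

Lemma pm_forces_logn2 n : (0 < n)%N -> logn 2 n = 2%N -> pm_forces n (2 * n).
Proof.
move=> n_gt0 logn2.
have [k odd_k def_n] := pfactor_coprime (isT : prime 2) n_gt0.
rewrite coprime2n in odd_k; rewrite logn2 mulnC in def_n; rewrite def_n.
(* For n = 4k the count is 4(2k-2) + 8 = 2n. *)
apply: pm_forces_leq (pm_forces_mul _ pm_forces_4 (pm_forces_odd odd_k)) => //.
by case: (k) odd_k => //= k' _; lia.
Qed.

(** Fourteen blocks of length [m] are formed and eight of them combined: 13m + (2m+1) terms
    suffice. *)
Lemma pm_forces_mul8 m : (0 < m)%N -> pm_forces m (2 * m + 1) ->
  pm_forces (m * 8) (15 * m + 1).
Proof.
move=> m_gt0 /pm_forces_mul/(_ pm_forces_8) forces.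
by apply: pm_forces_leq (forces m_gt0); lia.
Qed.

Lemma pm_forces_Zn2 n : (0 < n)%N -> pm_forces n (2 * n + 1).
Proof.
elim/ltn_ind: n => n IHn n_gt0.
have [log_ge3|log_lt3] := leqP 3 (logn 2 n).
  have /dvdnP[m def_n] : (2 ^ 3 %| n)%N by rewrite pfactor_dvdn.
  have m_gt0 : (0 < m)%N by move: n_gt0; rewrite def_n; case: (m).
  have lt_mn : (m < n)%N by rewrite def_n; lia.
  have := pm_forces_mul8 m_gt0 (IHn m lt_mn m_gt0); rewrite def_n.
  by apply: pm_forces_leq; lia.
have [k odd_k def_n] := pfactor_coprime (isT : prime 2) n_gt0.
rewrite coprime2n in odd_k.
case def_u : (logn 2 n) log_lt3 def_n => [|[|[|//]]] _ def_n.
- rewrite def_n muln1; apply: pm_forces_leq (pm_forces_odd odd_k); lia.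
- rewrite def_n mulnC.
  (* For n = 2k the count is 2(2k-2) + 5 = 2n+1. *)
  apply: pm_forces_leq (pm_forces_mul _ pm_forces_2 (pm_forces_odd odd_k)) => //.
  by case: (k) odd_k => //= k' _; lia.
- by apply: pm_forces_leq (pm_forces_logn2 n_gt0 def_u); lia.
Qed.

Theorem theorem4p3 (n : nat) (n_gt0 : (0 < n)%N) :
  (s_pm (Zn2 n) <= 2 * n + 1)%N /\
  [/\ [/\ s_pm (Zn2 2) = 5%N, s_pm (Zn2 4) = 8%N & s_pm (Zn2 8) = 14%N],
      (logn 2 n <= 1)%N -> (s_pm (Zn2 n) <= 2 * n + 1)%N,
      logn 2 n = 2%N -> (s_pm (Zn2 n) <= 2 * n)%N
    & (3 <= logn 2 n)%N ->
        (s_pm (Zn2 n))%:R <= 15%:R / 8%:R * n%:R + 1 :> rat].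
Proof.
have general := s_pm_leq n_gt0 (pm_forces_Zn2 n_gt0).
split; [exact: general | split; last 3 first].
- by move=> _; exact: general.
- by move=> logn2; apply: s_pm_leq (pm_forces_logn2 n_gt0 logn2).
- move=> log_ge3; have /dvdnP[m def_n] : (2 ^ 3 %| n)%N by rewrite pfactor_dvdn.
  have m_gt0 : (0 < m)%N by move: n_gt0; rewrite def_n; case: (m).
  have := pm_forces_mul8 m_gt0 (pm_forces_Zn2 m_gt0).
  rewrite -[8%N]/(2 ^ 3)%N -def_n => /(s_pm_leq n_gt0) le_s.
  apply: (@le_trans _ _ (15 * m + 1)%:R); first by rewrite ler_nat.
  by rewrite def_n !natrM natrD natrM; lra.
- split; apply/eqP; rewrite eqn_leq; apply/andP; split.
  + exact: (s_pm_leq _ pm_forces_2).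
  (* The four elements of the group are distinct, so no two of them have sum or difference zero. *)
  + by apply: (@s_pm_gt (Zn2 2) [seq (a, b) | a <- [:: 0; 1], b <- [:: 0; 1]]); rewrite exponent_Zn2 //;
      vm_compute.
  + exact: (s_pm_leq _ pm_forces_4).
  + by apply: (@s_pm_Zn2_lower 4 (powers_of_2 4 2)) => //; vm_compute.
  + exact: (s_pm_leq _ pm_forces_8).
  + by apply: (@s_pm_Zn2_lower 8 (powers_of_2 8 3)) => //; vm_compute.
Qed.
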